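(* Let $\mathbb{I}=(I,\le,\mathcal{I})$ be a set of indices, let $a\in A\in\mathcal{I}$, and let $(x_\varepsilon),(y_\varepsilon),(z_\varepsilon)\in\mathbb{R}^I$ be nets of real numbers. Then, as $\varepsilon\in\mathbb{I}$: (i) $x_\varepsilon=O_{a,A}(x_\varepsilon)$; (ii) if $x_\varepsilon=O_{a,A}(y_\varepsilon)$ and $y_\varepsilon=O_{a,A}(z_\varepsilon)$, then $x_\varepsilon=O_{a,A}(z_\varepsilon)$; (iii) $O_{a,A}(x_\varepsilon)\cdot O_{a,A}(y_\varepsilon)=O_{a,A}(x_\varepsilon\cdot y_\varepsilon)$; (iv) $O_{a,A}(x_\varepsilon)+O_{a,A}(y_\varepsilon)=O_{a,A}(|x_\varepsilon|+|y_\varepsilon|)$; (v) $x_\varepsilon\cdot O_{a,A}(y_\varepsilon)=O_{a,A}(x_\varepsilon\cdot y_\varepsilon)$; (vi) $O_{a,A}(x_\varepsilon)+O_{a,A}(x_\varepsilon)=O_{a,A}(x_\varepsilon)$; (vii) if $x_\varepsilon,y_\varepsilon\ge 0$ for all $\varepsilon\in I$, then $x_\varepsilon+O_{a,A}(y_\varepsilon)=O_{a,A}(x_\varepsilon+y_\varepsilon)$; (viii) for all $k\in\mathbb{R}$: $O_{a,A}(k\cdot x_\varepsilon)=O_{a,A}(x_\varepsilon)$; (ix) for all $k\in\mathbb{R}$: $k\cdot O_{a,A}(x_\varepsilon)=O_{a,A}(x_\varepsilon)$; (x) if $x_\varepsilon=O_{a,A}(y_\varepsilon)$ and $a\in B\subseteq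 A$ with $B\in\mathcal{I}$, then $x_\varepsilon=O_{a,B}(y_\varepsilon)$.
   Context: A set of indices is a triple $\mathbb{I}=(I,\le,\mathcal{I})$ such that: (1) $I$ is a nonempty set and $\le$ is a reflexive and transitive relation on $I$; (2) $\mathcal{I}$ is a set of subsets of $I$ with $\emptyset\notin\mathcal{I}$ and $I\in\mathcal{I}$; (3) for all $A,B\in\mathcal{I}$ there is $C\in\mathcal{I}$ with $C\subseteq A\cap B$; (4) writing $(\emptyset,e]:=\{\varepsilon\in I\mid\varepsilon\le e\}$, $A_{\le e}:=(\emptyset,e]\cap A$, and $\varepsilon<e$ for ''$\varepsilon\le e$ and $\varepsilon\neq e$'': whenever $e\le a\in A\in\mathcal{I}$, the set $A_{\le e}$ is nonempty and for all $b,c\in A_{\le e}$ there is $d\in A_{\le e}$ with $d<b$ and $d<c$. (It is not required that $e\in A$.) For $a\in A\in\mathcal{I}$ and nets $(x_\varepsilon),(y_\varepsilon)\in\mathbb{R}^I$, one writes $x_\varepsilon=O_{a,A}(y_\varepsilon)$ as $\varepsilon\in\mathbb{I}$ if there exist $H\in\mathbb{R}_{>0}$ and $\varepsilon_0\in A_{\le a}$ such that $|x_\varepsilon|\le H\cdot|y_\varepsilon|$ for all $\varepsilon\in A_{\le\varepsilon_0}$. Equalities between big-O expressions are read from left to right: e.g. (iii) means that if $x'_\varepsilon=O_{a,A}(x_\varepsilon)$ and $y'_\varepsilon=O_{a,A}(y_\varepsilon)$ then $x'_\varepsilon y'_\varepsilon=O_{a,A}(x_\varepsilon y_\varepsilon)$;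 (viii) means that $x'_\varepsilon=O_{a,A}(kx_\varepsilon)$ implies $x'_\varepsilon=O_{a,A}(x_\varepsilon)$; (ix) means that $x'_\varepsilon=O_{a,A}(x_\varepsilon)$ implies $kx'_\varepsilon=O_{a,A}(x_\varepsilon)$; and similarly for the others. *)

(* Defs.v *)
From mathcomp Require Import all_boot all_order all_algebra.
From mathcomp Require Import classical_sets reals.
Set Implicit Arguments.
Unset Strict Implicit.
Unset Printing Implicit Defensive.
Import Order.TTheory GRing.Theory Num.Theory.
Local Open Scope classical_set_scope.
Local Open Scope ring_scope.

Section Sections.
Variables (T : Type) (le : T -> T -> Prop).

(* The relation [le] is only a preorder, so [strict le e' e] is not the
   asymmetric part of [le]: it allows [le e e'] to hold as well. *)
Definition strict (e' e : T) : Prop := le e' e /\ e' <> e.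

Definition below (e : T) : set T := [set e' | le e' e].

(* A_{<= e}; the point e need not belong to A. *)
Definition section (A : set T) (e : T) : set T := below e `&` A.

End Sections.

Record set_of_indices := SetOfIndices {
  index :> Type;
  ile : index -> index -> Prop;
  isets : set (set index);
  index_nonempty : [set: index] !=set0;
  ile_refl : forall e, ile e e;
  ile_trans : forall e1 e2 e3, ile e1 e2 -> ile e2 e3 -> ile e1 e3;
  isets_set0 : ~ isets set0;
  isets_setT : isets setT;
  isets_refine : forall A B, isets A -> isets B ->
    exists2 C, isets C & C `<=` A `&` B;
  section_nonempty : forall A a e, isets A -> A a -> ile e a ->
    section ile A e !=set0;
  section_directed : forall A a e, isets A -> A a -> ile e a ->
    forall b c, section ile A e b -> section ile A e c ->
      exists d, [/\ section ile A e d, strict ile d b & strict ile d c]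
}.

Definition bigO_at (R : realType) (I : set_of_indices) (a : I) (A : set I)
    (x y : I -> R) : Prop :=
  exists H : R, exists e0 : I, [/\ 0 < H, section (@ile I) A a e0 &
    forall e, section (@ile I) A e0 e -> `|x e| <= H * `|y e|].

(* Main.v *)
Require Import Defs.
From mathcomp Require Import all_boot all_order all_algebra.
From mathcomp Require Import classical_sets reals.
Import Order.TTheory GRing.Theory Num.Theory.
Local Open Scope classical_set_scope.
Local Open Scope ring_scope.
Set Implicit Arguments.
Unset Strict Implicit.

(** Two big-O bounds hold below thresholds [b] and [c] in the section of [A] at [a]; directedness
    gives a point of that section under both, and below it the bounds hold together. Every rule with
    two premises thus reduces to a pointwise inequality between absolute values, which is
    [bigO_at_combine]. A bound valid on all of the index set needs only the threshold [a]
    ([bigO_at_dominated]). Transitivity, product and sum come from the former, scaling from the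
    latter, and the other rules for fixed [A] are chains of these. Only the passage to a smaller set
    [B] needs a new threshold, found in [B] by nonemptiness of its sections. *)

Lemma bigO_at_dominated (R : realType) (I : set_of_indices) (A : set I) (a : I)
    (x y : I -> R) (H : R) :
  isets A -> A a -> 0 < H -> (forall e, `|x e| <= H * `|y e|) ->
  bigO_at a A x y.
Proof.
move=> hA ha H0 xy; exists H, a; split=> //.
by split=> //; exact: ile_refl.
Qed.

(** Isolates the single use of directedness. The constant [L] may depend on [H] and [K] but not on
    the index [e]. *)
Lemma bigO_at_combine (R : realType) (I : set_of_indices) (A : set I) (a : I)
    (x x' y y' u v : I -> R) :
  isets A -> A a -> bigO_at a A x' x -> bigO_at a A y' y ->
  (forall H K, 0 < H -> 0 < K -> exists2 L, 0 < L & forall e,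
    `|x' e| <= H * `|x e| -> `|y' e| <= K * `|y e| -> `|u e| <= L * `|v e|) ->
  bigO_at a A u v.
Proof.
move=> hA ha [H [b [H0 sb hx]]] [K [c [K0 sc hy]]] /(_ H K H0 K0)[L L0 uv].
have [d [sd [db _] [dc _]]] := section_directed hA ha (ile_refl a) sb sc.
exists L, d; split=> // e [ed Ae].
apply: uv; first by apply: hx; split=> //; exact: ile_trans ed db.
by apply: hy; split=> //; exact: ile_trans ed dc.
Qed.

Lemma bigO_at_refl (R : realType) (I : set_of_indices) (A : set I) (a : I)
    (x : I -> R) :
  isets A -> A a -> bigO_at a A x x.
Proof.
by move=> hA ha; apply: (@bigO_at_dominated _ _ _ _ _ _ 1) => // e; rewrite mul1r.
Qed.

Lemma bigO_at_trans (R : realType) (I : set_of_indices) (A : set I) (a : I)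
    (x y z : I -> R) :
  isets A -> A a -> bigO_at a A x y -> bigO_at a A y z -> bigO_at a A x z.
Proof.
move=> hA ha xy yz; apply: (bigO_at_combine hA ha xy yz) => H K H0 K0.
exists (H * K); first exact: mulr_gt0.
by move=> e hx hy; rewrite (le_trans hx)// -mulrA ler_wpM2l// ltW.
Qed.

Lemma bigO_atM (R : realType) (I : set_of_indices) (A : set I) (a : I)
    (x x' y y' : I -> R) :
  isets A -> A a -> bigO_at a A x' x -> bigO_at a A y' y ->
  bigO_at a A (fun e => x' e * y' e) (fun e => x e * y e).
Proof.
move=> hA ha xx yy; apply: (bigO_at_combine hA ha xx yy) => H K H0 K0.
exists (H * K); first exact: mulr_gt0.
by move=> e hx hy; rewrite !normrM mulrACA ler_pM.
Qed.

(** The absolute values on the right are essential: [x e + y e] may cancel while [x' e + y' e] does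
    not. *)
Lemma bigO_atD (R : realType) (I : set_of_indices) (A : set I) (a : I)
    (x x' y y' : I -> R) :
  isets A -> A a -> bigO_at a A x' x -> bigO_at a A y' y ->
  bigO_at a A (fun e => x' e + y' e) (fun e => `|x e| + `|y e|).
Proof.
move=> hA ha xx yy; apply: (bigO_at_combine hA ha xx yy) => H K H0 K0.
exists (H + K); first exact: addr_gt0.
move=> e hx hy; rewrite (le_trans (ler_normD _ _))//.
rewrite [X in _ * X]ger0_norm ?addr_ge0// mulrDr lerD//.
  by rewrite (le_trans hx)// ler_wpM2r// lerDl ltW.
by rewrite (le_trans hy)// ler_wpM2r// lerDr ltW.
Qed.

Lemma bigO_at_scale (R : realType) (I : set_of_indices) (A : set I) (a : I)
    (k : R) (x : I -> R) :
  isets A -> A a -> bigO_at a A (fun e => k * x e) x.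
Proof.
(* Adding 1 keeps the constant positive when [k] is 0. *)
move=> hA ha; apply: (@bigO_at_dominated _ _ _ _ _ _ (`|k| + 1)) => //.
  by rewrite ltr_wpDl.
by move=> e; rewrite normrM ler_wpM2r// lerDl.
Qed.

Lemma bigO_at_subset (R : realType) (I : set_of_indices) (A B : set I) (a : I)
    (x y : I -> R) :
  isets B -> B a -> B `<=` A -> bigO_at a A x y -> bigO_at a B x y.
Proof.
move=> hB Ba BA [H [b [H0 [ba _] xy]]].
(* [b] need not lie in [B], but [b <= a] and [B a] make [section B b] nonempty. *)
have [c [cb Bc]] := section_nonempty hB Ba ba.
exists H, c; split=> //; first by split=> //; exact: ile_trans cb ba.
by move=> e [ec Be]; apply: xy; split; [exact: ile_trans ec cb | exact: BA].
Qed.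

Unset Implicit Arguments.
Set Strict Implicit.

Theorem theorem10 (R : realType) (I : set_of_indices) (A : set I) (a : I)
    (hA : isets A) (ha : A a) (x y z : I -> R) :
  (* (i) *)
  bigO_at a A x x /\
  (* (ii) *)
  (bigO_at a A x y -> bigO_at a A y z -> bigO_at a A x z) /\
  (* (iii) *)
  (forall x' y' : I -> R, bigO_at a A x' x -> bigO_at a A y' y ->
    bigO_at a A (fun e => x' e * y' e) (fun e => x e * y e)) /\
  (* (iv) *)
  (forall x' y' : I -> R, bigO_at a A x' x -> bigO_at a A y' y ->
    bigO_at a A (fun e => x' e + y' e) (fun e => `|x e| + `|y e|)) /\
  (* (v) *)
  (forall y' : I -> R, bigO_at a A y' y ->
    bigO_at a A (fun e => x e * y' e) (fun e => x e * y e)) /\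
  (* (vi) *)
  (forall x' x'' : I -> R, bigO_at a A x' x -> bigO_at a A x'' x ->
    bigO_at a A (fun e => x' e + x'' e) x) /\
  (* (vii) *)
  ((forall e : I, 0 <= x e /\ 0 <= y e) ->
    forall y' : I -> R, bigO_at a A y' y ->
    bigO_at a A (fun e => x e + y' e) (fun e => x e + y e)) /\
  (* (viii) *)
  (forall (k : R) (x' : I -> R), bigO_at a A x' (fun e => k * x e) ->
    bigO_at a A x' x) /\
  (* (ix) *)
  (forall (k : R) (x' : I -> R), bigO_at a A x' x ->
    bigO_at a A (fun e => k * x' e) x) /\
  (* (x) *)
  (bigO_at a A x y -> forall B : set I, isets B -> B a -> B `<=` A ->
    bigO_at a B x y).
Proof.
split; first exact: bigO_at_refl.
split; first exact: bigO_at_trans.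
split; first by move=> x' y'; exact: bigO_atM.
split; first by move=> x' y'; exact: bigO_atD.
split; first by move=> y'; apply: bigO_atM => //; exact: bigO_at_refl.
split.
  move=> x' x'' hx' hx''.
  apply: (bigO_at_trans hA ha (bigO_atD hA ha hx' hx'')).
  (* The sum rule leaves the bound [|x e| + |x e|], which is twice [|x e|]. *)
  apply: (@bigO_at_dominated _ _ _ _ _ _ 2) => // e.
  by rewrite ger0_norm ?addr_ge0// mulr_natl mulr2n.
split.
  move=> xy0 y' hy.
  apply: (bigO_at_trans hA ha
    (bigO_atD hA ha (bigO_at_refl x hA ha) hy)).
  (* Nonnegativity rules out cancellation, so [|x e| + |y e|] is [x e + y e] itself. *)
  apply: (@bigO_at_dominated _ _ _ _ _ _ 1) => // e.
  by have [x0 y0] := xy0 e; rewrite mul1r (ger0_norm x0) (ger0_norm y0).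
split.
  move=> k x' hx; apply: (bigO_at_trans hA ha hx).
  exact: bigO_at_scale.
split.
  (* The intermediate net is [x'], so it remains to scale [x'] and not [x]. *)
  move=> k x'; apply: bigO_at_trans => //.
  exact: bigO_at_scale.
by move=> xy B hB Ba BA; exact: bigO_at_subset BA xy.
Qed.
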